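(* Let $\mathbf V$ be a variety of algebras and let $\mathbf V[\mathbf{CHUnif}]$ be the category of complete, Hausdorff uniform algebras in $\mathbf V$, with uniformly continuous homomorphisms as arrows. Let $\mathbf M$ be the subcategory of uniformly continuous homomorphisms $f:\langle A,\mathcal U\rangle\to\langle B,\mathcal V\rangle$ such that $f$ is one-one and $\mathcal U=f^{-1}(\mathcal V)$. Let $\mathbf E$ be the subcategory of uniformly continuous homomorphisms $f:\langle A,\mathcal U\rangle\to\langle B,\mathcal V\rangle$ such that the image of $f$ is dense in $B$. Then $\langle\mathbf E,\mathbf M\rangle$ is a factorization system in $\mathbf V[\mathbf{CHUnif}]$.
   Context: A uniform algebra in $\mathbf V$ is a pair $\langle A,\mathcal U\rangle$ with $A\in\mathbf V$ (algebras may be empty) and $\mathcal U$ a uniformity on the underlying set of $A$ for which all basic operations are uniformly continuous. It is Hausdorff if $\bigcap\mathcal U$ is the diagonal, and complete if every Cauchy net converges. Density refers to the topology of the uniformity. For $f:A\to B$ and a uniformity $\mathcal V$ on $B$, $f^{-1}(\mathcal V)$ is the uniformity on $A$ with base $\{f^{-1}(V)\mid V\in\mathcal V\}$, where $f^{-1}(V)=\{\langle x,y\rangle\mid\langle f(x),f(y)\rangle\in V\}$. A factorization system in a category $\mathbf C$ is a pair $\langle\mathbf E,\mathbf M\rangle$ of subcategories of $\mathbf C$ such that: (F1) if $e\in\mathbf E$, $h$ is an isomorphism and $he$ exists then $he\in\mathbf E$, and if $m\in\mathbf M$, $h$ is an isomorphism and $mh$ exists then $mh\in\mathbf M$; (F2)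 every arrow $f$ of $\mathbf C$ factors as $f=me$ with $m\in\mathbf M$, $e\in\mathbf E$; (F3) for every commutative square $mf=ge$ with $e:x\to y$ in $\mathbf E$, $m:z\to w$ in $\mathbf M$, $f:x\to z$, $g:y\to w$, there is a unique arrow $\delta:y\to z$ with $\delta e=f$ and $m\delta=g$; (F4) every isomorphism belongs both to $\mathbf E$ and to $\mathbf M$. *)

(* Defs.v *)
From HB Require Import structures.
From mathcomp Require Import all_boot.
From mathcomp Require Import all_classical topology.

Set Implicit Arguments.
Unset Strict Implicit.
Unset Printing Implicit Defensive.

Local Open Scope classical_set_scope.

Record category := Category {
  obj :> Type;
  hom : obj -> obj -> Type;
  idm : forall x, hom x x;
  (* [comp g f] is "g after f" *)
  comp : forall x y z, hom y z -> hom x y -> hom x z;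
  comp_idl : forall x y (f : hom x y), comp (idm y) f = f;
  comp_idr : forall x y (f : hom x y), comp f (idm x) = f;
  comp_assoc : forall x y z w (h : hom z w) (g : hom y z) (f : hom x y),
    comp h (comp g f) = comp (comp h g) f
}.
Arguments hom {c} x y.
Arguments idm {c} x.
Arguments comp {c x y z} g f.

Definition is_iso (C : category) (x y : C) (f : hom x y) : Prop :=
  exists g : hom y x, comp g f = idm x /\ comp f g = idm y.

Record subcategory (C : category) := Subcategory {
  sub_obj : C -> Prop;
  sub_hom : forall x y : C, hom x y -> Prop;
  sub_dom : forall x y (f : hom x y), sub_hom f -> sub_obj x;
  sub_cod : forall x y (f : hom x y), sub_hom f -> sub_obj y;
  sub_idm : forall x, sub_obj x -> sub_hom (idm x);
  sub_comp : forall x y z (g : hom y z) (f : hom x y),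
    sub_hom g -> sub_hom f -> sub_hom (comp g f)
}.
Arguments sub_hom {C} s {x y}.

Record is_factorization_system (C : category) (E M : subcategory C) : Prop := {
  fact_iso_l : forall (x y z : C) (e : hom x y) (h : hom y z),
    sub_hom E e -> is_iso h -> sub_hom E (comp h e);
  fact_iso_r : forall (x y z : C) (h : hom x y) (m : hom y z),
    sub_hom M m -> is_iso h -> sub_hom M (comp m h);
  fact_factor : forall (x y : C) (f : hom x y),
    exists (z : C) (m : hom z y) (e : hom x z),
      [/\ sub_hom M m, sub_hom E e & f = comp m e];
  fact_diag : forall (x y z w : C)
      (e : hom x y) (m : hom z w) (f : hom x z) (g : hom y w),
    sub_hom E e -> sub_hom M m -> comp m f = comp g e ->
    exists! d : hom y z, comp d e = f /\ comp m d = g;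
  fact_iso : forall (x y : C) (h : hom x y),
    is_iso h -> sub_hom E h /\ sub_hom M h
}.

Record signature := Signature {
  op_symbol :> Type;
  arity : op_symbol -> nat
}.
Arguments arity {s} w.

Record algebra (S : signature) := Algebra {
  carrier :> Type;
  op : forall w : S, ('I_(arity w) -> carrier) -> carrier
}.
Arguments op {S} a w x.

Inductive term (S : signature) : Type :=
| Var : nat -> term S
| App : forall w : S, ('I_(arity w) -> term S) -> term S.
Arguments Var {S} n.

Fixpoint eval (S : signature) (A : algebra S) (v : nat -> A) (t : term S) : A :=
  match t with
  | Var n => v n
  | App w args => op A w (fun i => eval v (args i))
  end.

Definition satisfies (S : signature) (A : algebra S) (i : term S * term S) :=
  forall v : nat -> A, eval v i.1 = eval v i.2.

Definition is_variety (S : signature) (V : algebra S -> Prop) : Prop :=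
  exists Id : set (term S * term S),
    forall A, V A <-> forall i, Id i -> satisfies A i.

Definition is_alg_hom (S : signature) (A B : algebra S) (f : A -> B) : Prop :=
  forall (w : S) (x : 'I_(arity w) -> A), f (op A w x) = op B w (f \o x).

Definition directed (I : Type) (le : I -> I -> Prop) : Prop :=
  [/\ inhabited I,
      forall i, le i i,
      forall i j k, le i j -> le j k -> le i k &
      forall i j, exists k, le i k /\ le j k].

Definition net_cauchy (T : uniformType) (I : Type) (le : I -> I -> Prop)
    (x : I -> T) : Prop :=
  forall U, entourage U ->
    exists i, forall j k, le i j -> le i k -> U (x j, x k).

Definition net_converges (T : topologicalType) (I : Type) (le : I -> I -> Prop)
    (x : I -> T) (a : T) : Prop :=
  forall N, nbhs a N -> exists i, forall j, le i j -> N (x j).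

(* The library's [completeType] is restricted to pointed spaces, and so
   excludes the empty one. *)
Definition unif_complete (T : uniformType) : Prop :=
  forall (I : Type) (le : I -> I -> Prop) (x : I -> T),
    directed le -> net_cauchy le x -> exists a, net_converges le x a.

Definition unif_hausdorff (T : uniformType) : Prop :=
  \bigcap_(U in @entourage T) U = diagonal.

(* [{ptws 'I_n -> T}] is T^n with the product uniformity. *)
Record unif_algebra (S : signature) := UnifAlgebra {
  ua_space :> uniformType;
  ua_op : forall w : S, {ptws 'I_(arity w) -> ua_space} -> ua_space;
  ua_op_unif : forall w : S, unif_continuous (ua_op (w := w))
}.

Definition ua_alg (S : signature) (A : unif_algebra S) : algebra S :=
  @Algebra S (ua_space A) (@ua_op S A).

Record chunif_algebra (S : signature) (V : algebra S -> Prop) := CHUnifAlgebra {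
  ch_ua :> unif_algebra S;
  ch_in : V (ua_alg ch_ua);
  ch_hausdorff : unif_hausdorff ch_ua;
  ch_complete : unif_complete ch_ua
}.

Record unif_hom (S : signature) (A B : unif_algebra S) := UnifHom {
  uh_fun :> A -> B;
  uh_alg_hom : @is_alg_hom S (ua_alg A) (ua_alg B) uh_fun;
  uh_unif : unif_continuous uh_fun
}.

Lemma unif_hom_eq (S : signature) (A B : unif_algebra S) (f g : unif_hom A B) :
  uh_fun f = uh_fun g -> f = g.
Proof.
case: f g => [f hf cf] [g hg cg] /= fg; case: g / fg hg cg => hg cg.
by rewrite (Prop_irrelevance hf hg) (Prop_irrelevance cf cg).
Qed.

Lemma unif_continuous_comp (A B C : uniformType) (g : B -> C) (f : A -> B) :
  unif_continuous g -> unif_continuous f -> unif_continuous (g \o f).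
Proof. by move=> cg cf U /cg /cf. Qed.

Lemma unif_continuous_continuous (A B : uniformType) (f : A -> B) :
  unif_continuous f -> continuous f.
Proof.
move=> cf x; apply/cvg_app_entourageP => U /cf entU.
by apply: filterS (nbhs_entourage x entU) => y /xsectionP.
Qed.

Lemma id_alg_hom (S : signature) (A : algebra S) : is_alg_hom (@id A).
Proof. by []. Qed.

Lemma comp_alg_hom (S : signature) (A B C : algebra S) (g : B -> C)
  (f : A -> B) : is_alg_hom g -> is_alg_hom f -> is_alg_hom (g \o f).
Proof. by move=> hg hf w x; rewrite /= (hf w x) (hg w). Qed.

Lemma id_unif_continuous (A : uniformType) : unif_continuous (@id A).
Proof. by move=> U entU; apply: filterS entU => -[]. Qed.

Lemma dense_id (A : topologicalType) : dense (range (@id A)).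
Proof. by move=> O [x Ox] _; exists x; split=> //; exists x. Qed.

Lemma dense_comp (A B C : topologicalType) (g : B -> C) (f : A -> B) :
  continuous g -> dense (range g) -> dense (range f) -> dense (range (g \o f)).
Proof.
move=> cg dg df O O0 oO.
have [z [Oz [y _ gy]]] := dg _ O0 oO.
have oO' : open (g @^-1` O) by apply: open_comp oO => x _; exact: cg.
have O'y : O (g y) by rewrite gy.
have [w [Ow [x _ fx]]] := df _ (ex_intro _ y O'y) oO'.
by exists (g w); split=> //; exists x; rewrite //= fx.
Qed.

Definition preimage_uniformity (A : Type) (B : uniformType) (f : A -> B) :
    set_system (A * A) :=
  filter_from entourage (fun V => [set xy | V (f xy.1, f xy.2)]).

Definition is_unif_embedding (A B : uniformType) (f : A -> B) : Prop :=
  injective f /\ @entourage A = preimage_uniformity f.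

Lemma unif_embedding_id (A : uniformType) : is_unif_embedding (@id A).
Proof.
split=> //; apply/seteqP; split=> [U entU|U [W entW WU]].
  by exists U => // -[].
by apply: filterS entW => -[x y] Wxy; apply: WU.
Qed.

Lemma unif_embedding_comp (A B C : uniformType) (g : B -> C) (f : A -> B) :
  is_unif_embedding g -> is_unif_embedding f -> is_unif_embedding (g \o f).
Proof.
move=> [ginj gE] [finj fE]; split; first exact: inj_comp.
rewrite fE /preimage_uniformity gE; apply/seteqP; split.
  by move=> U [W [W' eW' W'W] WU]; exists W' => // xy xyW; apply/WU/W'W.
by move=> U [W eW WU]; exists [set xy | W (g xy.1, g xy.2)] => //; exists W.
Qed.

Section CHUnif.
Variables (S : signature) (V : algebra S -> Prop).
Implicit Types A B C D : chunif_algebra V.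

Definition unif_hom_id A : unif_hom A A :=
  UnifHom (@id_alg_hom S (ua_alg A)) (@id_unif_continuous A).

Definition unif_hom_comp A B C (g : unif_hom B C) (f : unif_hom A B) :
    unif_hom A C :=
  UnifHom (comp_alg_hom (uh_alg_hom g) (uh_alg_hom f))
          (unif_continuous_comp (uh_unif g) (uh_unif f)).

Lemma unif_hom_comp_idl A B (f : unif_hom A B) :
  unif_hom_comp (unif_hom_id B) f = f.
Proof. exact: unif_hom_eq. Qed.

Lemma unif_hom_comp_idr A B (f : unif_hom A B) :
  unif_hom_comp f (unif_hom_id A) = f.
Proof. exact: unif_hom_eq. Qed.

Lemma unif_hom_comp_assoc A B C D (h : unif_hom C D) (g : unif_hom B C)
    (f : unif_hom A B) :
  unif_hom_comp h (unif_hom_comp g f) = unif_hom_comp (unif_hom_comp h g) f.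
Proof. exact: unif_hom_eq. Qed.

Definition CHUnif : category :=
  @Category (chunif_algebra V) (fun A B => unif_hom A B)
    unif_hom_id unif_hom_comp
    unif_hom_comp_idl unif_hom_comp_idr unif_hom_comp_assoc.

Definition subM : subcategory CHUnif :=
  @Subcategory CHUnif (fun _ => True)
    (fun A B (f : unif_hom A B) => is_unif_embedding f)
    (fun _ _ _ _ => Logic.I) (fun _ _ _ _ => Logic.I)
    (fun A _ => @unif_embedding_id A)
    (fun A B C g f => @unif_embedding_comp A B C g f).

Definition subE : subcategory CHUnif :=
  @Subcategory CHUnif (fun _ => True)
    (fun A B (f : unif_hom A B) => dense (range f))
    (fun _ _ _ _ => Logic.I) (fun _ _ _ _ => Logic.I)
    (fun A _ => @dense_id A)
    (fun A B C (g : unif_hom B C) (f : unif_hom A B) =>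
       dense_comp (unif_continuous_continuous (uh_unif g))).

End CHUnif.

(* Main.v *)
(* The middle object of the factorization of [f] is the closure of its image:
   operations being continuous, it is a subalgebra, and it lies in the variety
   and is complete as a closed subspace. For the diagonal of [m f = g e], the
   range of [m] is closed because its domain is complete; since [g e] lands in
   it and [e] is dense, so does [g], and [m^-1 g] is the diagonal. *)
Require Import Defs.
From mathcomp Require Import all_boot finmap.
From mathcomp Require Import all_classical topology.

Set Implicit Arguments.
Unset Strict Implicit.
Unset Printing Implicit Defensive.

Local Open Scope classical_set_scope.

(** * Nets, limits and closures *)

Lemma unif_hausdorffP (T : uniformType) (a b : T) : unif_hausdorff T ->
  (forall U, entourage U -> U (a, b)) -> a = b.
Proof.
move=> hT ab; have : (\bigcap_(U in @entourage T) U) (a, b) by [].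
by rewrite hT => /diagonalP.
Qed.

Lemma net_converges_closed (T : topologicalType) (I : Type)
    (le : I -> I -> Prop) (x : I -> T) (C : set T) (a : T) :
  directed le -> closed C -> (forall i, C (x i)) -> net_converges le x a ->
  C a.
Proof.
move=> [_ lexx _ _] cC Cx xa; apply: cC => N /xa[i iN].
by exists (x i); split=> //; exact: iN.
Qed.

Lemma net_converges_comp (S T : topologicalType) (f : S -> T) (I : Type)
    (le : I -> I -> Prop) (x : I -> S) (a : S) :
  {for a, continuous f} -> net_converges le x a ->
  net_converges le (f \o x) (f a).
Proof. by move=> cf xa N /cf/xa. Qed.

Lemma net_converges_unique (T : uniformType) (I : Type) (le : I -> I -> Prop)
    (x : I -> T) (a b : T) :
  unif_hausdorff T -> directed le -> net_converges le x a ->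
  net_converges le x b -> a = b.
Proof.
move=> hT [_ _ _ dle] xa xb; apply: unif_hausdorffP => // U entU.
have /xa[i iU] := nbhs_entourage a (entourage_split_ent entU).
have /xb[j jU] :=
  nbhs_entourage b (entourage_inv (entourage_split_ent entU)).
have [k [ik jk]] := dle i j.
apply: (entourage_split (x k)) => //; first exact/xsectionP/iU.
by have /xsectionP := jU _ jk.
Qed.

(** The net is indexed by the neighbourhoods of [b] under reverse inclusion, with a point of [C]
    chosen in each. *)
Lemma closure_net (T : topologicalType) (C : set T) (b : T) : closure C b ->
  exists (I : Type) (le : I -> I -> Prop) (x : I -> T),
    [/\ directed le, forall i, C (x i) & net_converges le x b].
Proof.
move=> Cb.
pose I := {N : set T | nbhs b N}.
pose le (M N : I) := projT1 N `<=` projT1 M.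
have /choice[x xP] (N : I) : exists t, C t /\ projT1 N t.
  by have [t [Ct Nt]] := Cb _ (projT2 N); exists t.
exists I, le, x; split; last 2 first.
- by move=> N; have [] := xP N.
- move=> N bN; exists (exist _ N bN) => M; apply.
  by have [] := xP M.
split=> [|N|M N P MN NP|M N].
- by exists; exists setT; exact: filterT.
- exact: subset_refl.
- exact: subset_trans NP MN.
- have MN : nbhs b (projT1 M `&` projT1 N).
    by apply: filterI; [exact: (projT2 M)|exact: (projT2 N)].
  by exists (exist _ _ MN); split=> t [].
Qed.

Lemma net_converges_cauchy (T : uniformType) (I : Type) (le : I -> I -> Prop)
    (x : I -> T) (a : T) :
  net_converges le x a -> net_cauchy le x.
Proof.
move=> xa U entU; have entU' := entourage_split_ent entU.
(* Symmetrizing the half-size entourage lets one neighbourhood of [a] control both [(x j, a)] and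
   [(a, x k)]. *)
have /xa[i iU] := nbhs_entourage a (entourage_invI entU').
exists i => j k ij ik; apply: (entourage_split a) => //.
  by have /xsectionP[] := iU j ij.
by have /xsectionP[] := iU k ik.
Qed.

(** * Uniform embeddings, closed ranges and dense ranges *)

Lemma unif_continuous_ex (A B : uniformType) (f : A -> B) :
  (forall W, entourage W ->
    exists2 U, entourage U & forall x y, U (x, y) -> W (f x, f y)) ->
  unif_continuous f.
Proof.
move=> fU W /fU[U entU UW]; rewrite nbhs_simpl.
by apply: filterS entU => -[x y]; exact: UW.
Qed.

Lemma unif_embedding_entourage (A B : uniformType) (f : A -> B)
    (U : set (A * A)) :
  is_unif_embedding f -> entourage U ->
  exists2 W, entourage W & forall x y, W (f x, f y) -> U (x, y).
Proof.
by case=> _ -> [W entW WU]; exists W => // x y Wxy; apply: WU.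
Qed.

Lemma unif_embedding_unif_continuous (A B : uniformType) (f : A -> B) :
  is_unif_embedding f -> unif_continuous f.
Proof. by case=> _ fE W entW; rewrite nbhs_simpl fE; exists W. Qed.

Lemma unif_embedding_net_cauchy (A B : uniformType) (f : A -> B) (I : Type)
    (le : I -> I -> Prop) (x : I -> A) :
  is_unif_embedding f -> net_cauchy le (f \o x) -> net_cauchy le x.
Proof.
move=> ef xc U /(unif_embedding_entourage ef)[W entW WU].
by have [i iW] := xc W entW; exists i => j k ij ik; exact/WU/iW.
Qed.

(** Every neighbourhood of [a] contains a section of the preimage of some entourage of [B], so
    convergence can be tested in [B]. *)
Lemma unif_embedding_net_converges (A B : uniformType) (f : A -> B) (I : Type)
    (le : I -> I -> Prop) (x : I -> A) (a : A) :
  is_unif_embedding f -> net_converges le (f \o x) (f a) ->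
  net_converges le x a.
Proof.
move=> ef xa N /nbhsP[U /(unif_embedding_entourage ef)[W entW WU] UN].
have [i iW] := xa _ (nbhs_entourage (f a) entW).
by exists i => j ij; apply/UN/xsectionP/WU; have /xsectionP := iW j ij.
Qed.

(** A net in the range converging to [b] is Cauchy, hence lifts to a Cauchy net of [A]. Its limit in
    [A] is sent to [b], since limits in [B] are unique. *)
Lemma unif_embedding_closed (A B : uniformType) (f : A -> B) :
  is_unif_embedding f -> unif_complete A -> unif_hausdorff B ->
  closed (range f).
Proof.
move=> ef cA hB b /closure_net[I [le [y [dle yf yb]]]].
have /choice[x xP] i : exists a, f a = y i by have [a] := yf i; exists a.
have {}xP : f \o x = y by apply/funext.
have [a xa] : exists a, net_converges le x a.
  apply: cA => //; apply: (unif_embedding_net_cauchy ef).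
  by rewrite xP; exact: net_converges_cauchy yb.
exists a => //; apply: (net_converges_unique hB dle _ yb).
rewrite -xP; apply: net_converges_comp xa.
exact/unif_continuous_continuous/unif_embedding_unif_continuous.
Qed.

(** The image of a Cauchy net converges in [B], its limit stays in the closed range, and the
    embedding reflects the convergence. *)
Lemma unif_embedding_complete (A B : uniformType) (f : A -> B) :
  is_unif_embedding f -> closed (range f) -> unif_complete B ->
  unif_complete A.
Proof.
move=> ef clf cB I le x dle xc.
have [b xb] : exists b, net_converges le (f \o x) b.
  apply: cB => // U entU.
  exact: xc (unif_embedding_unif_continuous ef entU).
have [a _ fa] : range f b.
  by apply: net_converges_closed xb => // i; exists (x i).
by exists a; apply: (unif_embedding_net_converges ef); rewrite fa.
Qed.

Lemma unif_embedding_hausdorff (A B : uniformType) (f : A -> B) :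
  is_unif_embedding f -> unif_hausdorff B -> unif_hausdorff A.
Proof.
move=> ef hB; apply/seteqP; split=> -[x y]; last first.
  by move=> /diagonalP -> U entU; exact: entourage_refl.
move=> xy; apply/diagonalP/(proj1 ef)/(unif_hausdorffP hB) => U entU.
exact: xy (unif_embedding_unif_continuous ef entU).
Qed.

(** A set seen as a type carries the initial uniformity along [set_val], which is
    [preimage_uniformity] by conversion. *)
Lemma set_val_embedding (T : uniformType) (C : set T) :
  is_unif_embedding (set_val : C -> T).
Proof. by split=> //; exact: val_inj. Qed.

Lemma range_set_val (T : Type) (C : set T) : range (set_val : C -> T) = C.
Proof.
apply/seteqP; split=> [_ [x _ <-]|x Cx]; first exact: set_valP.
by exists (SigSub (mem_set Cx)).
Qed.

Lemma dense_range_closed (A B : topologicalType) (f : A -> B) (C : set B) :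
  dense (range f) -> closed C -> (forall x, C (f x)) -> forall y, C y.
Proof.
move=> df cC Cf y; apply: contrapT => nCy.
have [|z [nCz [x _ fxz]]] := df (~` C) (ex_intro _ y nCy).
  exact: closed_openC.
by apply: nCz; rewrite -fxz; exact: Cf.
Qed.

(** * A base of the uniformity of a finite power *)

(* The index type of the library's subbase of the product uniformity. *)
Definition coordinate_entourage (n : nat) (T : uniformType) :=
  {p : {classic 'I_n} * set ({ptws 'I_n -> T} * {ptws 'I_n -> T}) |
    `[< @entourage (initial_topology (@proj 'I_n (fun=> T) p.1)) p.2 >]}.

Lemma ptws_entourage (n : nat) (T : uniformType) (U : set (T * T)) :
  entourage U ->
  @entourage {ptws 'I_n -> T} [set xy | forall i, U (xy.1 i, xy.2 i)].
Proof.
move=> entU.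
pose E i : set ({ptws 'I_n -> T} * {ptws 'I_n -> T}) :=
  [set xy | U (xy.1 i, xy.2 i)].
(* As there are finitely many coordinates, it suffices to constrain one at a time. *)
suff entE i : @entourage {ptws 'I_n -> T} (E i) by exact: filter_forall entE.
have entEi : @entourage (initial_topology (@proj 'I_n (fun=> T) i)) (E i).
  by exists U.
pose p : coordinate_entourage n T :=
  exist _ (i : {classic 'I_n}, E i) (introT (asboolP _) entEi).
(* [E i] is subbasic, so it is the intersection of the one-element family [p]. *)
exists (E i) => //; exists [fset p]%fset; first by move=> q _; exact: in_setT.
by rewrite set_fset1 bigcap_set1.
Qed.

(** [E] contains a finite intersection of subbasic entourages, each implied by some [W p] on a
    single coordinate. Intersecting all the [W p] gives one entourage that serves every
    coordinate. *)
Lemma ptws_entourage_sub (n : nat) (T : uniformType)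
    (E : set ({ptws 'I_n -> T} * {ptws 'I_n -> T})) :
  entourage E ->
  exists2 U, entourage U &
    forall x y : 'I_n -> T, (forall i, U (x i, y i)) -> E (x, y).
Proof.
case=> _ [F _ <-] FE.
have /choice[W WP] (p : coordinate_entourage n T) :
    exists W : set (T * T), entourage W /\
    forall x y, W (x (projT1 p).1, y (projT1 p).1) -> (projT1 p).2 (x, y).
  case: p => -[i D] /= /asboolP[W entW WD].
  by exists W; split=> // x y Wxy; exact: WD.
exists (\bigcap_(p in [set` F]) W p).
  by apply: filter_bigI => p _; exact: (proj1 (WP p)).
move=> x y xyW; apply: FE => p pF.
exact/(proj2 (WP p))/(xyW _ p pF).
Qed.

(** * Identities and injective homomorphisms *)

Lemma eval_hom (S : signature) (A B : algebra S) (f : A -> B) v t :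
  is_alg_hom f -> f (Defs.eval v t) = Defs.eval (f \o v) t.
Proof.
move=> hf; elim: t => //= w args IH; rewrite hf; congr (op B w _).
exact/funext.
Qed.

(** Both sides of an identity commute with [f], agree in [B], and so agree in [A] by injectivity. *)
Lemma variety_injective_hom (S : signature) (V : algebra S -> Prop)
    (A B : algebra S) (f : A -> B) :
  is_variety V -> is_alg_hom f -> injective f -> V B -> V A.
Proof.
move=> [Id VE] hf finj /VE VB; apply/VE => i Idi v.
by apply: finj; rewrite !eval_hom //; exact: VB.
Qed.

(** * Factorization through the closure of the image *)

Section ClosureOfRange.
Variables (S : signature) (V : algebra S -> Prop) (hV : is_variety V).
Variables (A B : chunif_algebra V) (f : unif_hom A B).

Let C : set B := closure (range f).

(** Approximate each [x i] by some [f (a i)]. By uniform continuity the operation at [x] is then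
    close to its value at [f \o a], which is the image under [f] of the operation at [a]. *)
Lemma closure_range_op_closed (w : S) (x : 'I_(arity w) -> B) :
  (forall i, C (x i)) -> C (ua_op (w := w) x).
Proof.
move=> Cx N /nbhsP[W entW WN].
have [U entU UW] := ptws_entourage_sub (ua_op_unif w entW).
have /choice[a aU] i : exists a, U (x i, f a).
  have [_ [[a _ <-] /xsectionP]] := Cx i _ (nbhs_entourage (x i) entU).
  by exists a.
exists (f (ua_op (w := w) a)); split; first by exists (ua_op (w := w) a).
apply/WN/xsectionP; rewrite (uh_alg_hom f (w := w)).
exact: (UW x (f \o a)).
Qed.

Definition closure_range_op (w : S) (x : {ptws 'I_(arity w) -> C}) : C :=
  SigSub (mem_set (@closure_range_op_closed w (set_val \o x)
    (fun i => set_valP (x i)))).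

Lemma closure_range_op_unif (w : S) :
  unif_continuous (@closure_range_op w).
Proof.
apply: unif_continuous_ex => W [W' entW' W'W].
have [U entU UW] := ptws_entourage_sub (ua_op_unif w entW').
pose UC : set (C * C) := [set xy | U (set_val xy.1, set_val xy.2)].
have entUC : entourage UC by exists U.
exists [set xy | forall i, UC (xy.1 i, xy.2 i)]; first exact: ptws_entourage.
by move=> x y xyU; apply: W'W; exact: (UW (set_val \o x) (set_val \o y)).
Qed.

Definition closure_range_ua : unif_algebra S :=
  UnifAlgebra closure_range_op_unif.

Lemma set_val_alg_hom :
  @is_alg_hom S (ua_alg closure_range_ua) (ua_alg B) set_val.
Proof. by []. Qed.

Definition closure_range : chunif_algebra V :=
  @CHUnifAlgebra S V closure_range_ua
    (variety_injective_hom hV set_val_alg_hom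
      (proj1 (set_val_embedding C)) (ch_in B))
    (unif_embedding_hausdorff (set_val_embedding C) (@ch_hausdorff _ _ B))
    (unif_embedding_complete (set_val_embedding C)
      (eq_ind_r closed (@closed_closure _ (range f)) (range_set_val C))
      (@ch_complete _ _ B)).

Definition closure_range_incl : unif_hom closure_range B :=
  @UnifHom S closure_range B set_val set_val_alg_hom
    (unif_embedding_unif_continuous (set_val_embedding C)).

Definition closure_range_fun (a : A) : C :=
  SigSub (mem_set (subset_closure (imageT f a))).

Lemma closure_range_fun_alg_hom :
  @is_alg_hom S (ua_alg A) (ua_alg closure_range_ua) closure_range_fun.
Proof. by move=> w x; apply: val_inj; exact: (uh_alg_hom f). Qed.

Lemma closure_range_fun_unif : unif_continuous closure_range_fun.
Proof.
apply: unif_continuous_ex => W [W' /(uh_unif f) entW' W'W].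
by exists [set xy | W' (f xy.1, f xy.2)] => // x y xyW; exact: W'W.
Qed.

Definition closure_range_corestr : unif_hom A closure_range :=
  @UnifHom S A closure_range closure_range_fun
    closure_range_fun_alg_hom closure_range_fun_unif.

Lemma dense_closure_range_fun : dense (range closure_range_fun).
Proof.
(* An open set of the subspace is the trace of an open [O] of [B]; a point of the closure in [O]
   forces [O] to meet the image of [f]. *)
move=> P [[y Cy] Py] [O oO OP]; have Oy : O y by move: Py; rewrite -OP.
have [_ [[a _ <-] Oa]] := set_mem Cy _ (open_nbhs_nbhs (conj oO Oy)).
by exists (closure_range_fun a); rewrite -OP; split=> //; exists a.
Qed.

End ClosureOfRange.

(** * Diagonals of commutative squares *)

Section Diagonal.
Variables (S : signature) (V : algebra S -> Prop).
Variables (A B C D : chunif_algebra V).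
Variables (e : unif_hom A B) (m : unif_hom C D).
Variables (f : unif_hom A C) (g : unif_hom B D).

(** Only the triangle through [m] is asked for: the one through [e] follows from it because [m] is
    injective. *)
Lemma unif_hom_diagonal :
  dense (range e) -> is_unif_embedding m -> (forall x, m (f x) = g (e x)) ->
  exists d : unif_hom B C, forall y, m (d y) = g y.
Proof.
move=> de em mfge.
have /choice[d md] y : exists z, m z = g y.
  have clm : closed (range m).
    exact: unif_embedding_closed (@ch_complete _ _ C) (@ch_hausdorff _ _ D).
  (* This closed set contains the dense range of [e], hence is all of [B]. *)
  have clg : closed (g @^-1` range m).
    apply: preimage_closed clm => z _.
    exact: unif_continuous_continuous (uh_unif g) z.
  have [|z _ <-] := dense_range_closed de clg _ y; last by exists z.
  by move=> x; exists (f x).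
have dh : @is_alg_hom S (ua_alg B) (ua_alg C) d.
  move=> w x; apply: (proj1 em).
  rewrite md (uh_alg_hom g) (uh_alg_hom m).
  by rewrite (_ : m \o (d \o x) = g \o x) //; apply/funext => i /=; rewrite md.
have dc : unif_continuous d.
  (* [U] is controlled by an entourage [W] of [D] along [m]; since [m \o d] is [g], pulling [W] back
     along [g] gives the required entourage of [B]. *)
  apply: unif_continuous_ex => U /(unif_embedding_entourage em).
  move=> [W /(uh_unif g) entW WU].
  exists [set xy | W (g xy.1, g xy.2)] => // x y Wxy.
  by apply: WU; rewrite !md.
by exists (@UnifHom S B C d dh dc).
Qed.

End Diagonal.

(** * Isomorphisms and the axioms of a factorization system *)

Lemma iso_subEM (S : signature) (V : algebra S -> Prop) (x y : CHUnif V)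
    (h : hom x y) :
  is_iso h -> sub_hom (subE V) h /\ sub_hom (subM V) h.
Proof.
move=> [g [/(congr1 (@uh_fun _ _ _))/= gh /(congr1 (@uh_fun _ _ _))/= hg]].
have hK a : g (h a) = a := congr1 (@^~ a) gh.
have gK b : h (g b) = b := congr1 (@^~ b) hg.
split=> /=.
  by move=> O [b Ob] _; exists b; split=> //; exists (g b).
split; first exact: can_inj hK.
apply/seteqP; split=> [U entU|U [W entW WU]].
  (* Pulling [U] back along the inverse [g] and then along [h] returns [U]. *)
  exists [set b | U (g b.1, g b.2)]; first exact: (uh_unif g entU).
  by move=> -[a b] /=; rewrite !hK.
exact: filterS WU (uh_unif h entW).
Qed.

Theorem theorem13p1 (S : signature) (V : algebra S -> Prop) (hV : is_variety V) :
  is_factorization_system (subE V) (subM V).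
Proof.
(* Closure under composition with isomorphisms reduces to closure under composition, isomorphisms
   being in both classes. *)
split=> [x y z e h Ee /iso_subEM[Eh _]|x y z h m Mm /iso_subEM[_ Mh]|x y f| |].
- exact: sub_comp.
- exact: sub_comp.
- exists (closure_range hV f), (closure_range_incl hV f),
    (closure_range_corestr hV f); split.
  + exact: set_val_embedding.
  + exact: dense_closure_range_fun.
  + exact: unif_hom_eq.
- move=> x y z w e m f g Ee Mm mfge.
  have mfgeE a : m (f a) = g (e a) := congr1 (fun k => uh_fun k a) mfge.
  have [d md] := unif_hom_diagonal Ee Mm mfgeE.
  exists d; split.
    split; apply/unif_hom_eq/funext => a; last exact: md.
    (* After [m], both [d e] and [f] become [g e]. *)
    by apply: (proj1 Mm); rewrite md mfgeE.
  (* Uniqueness: [m d'] and [m d] both equal [g], and [m] is injective. *)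
  move=> d' [_ md']; apply/unif_hom_eq/funext => b; apply: (proj1 Mm).
  by rewrite md -md'.
- exact: iso_subEM.
Qed.
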